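(* Let $T>0$ and, for $i=1,\dots,n$, let $a_i,b_i\colon\mathbb{R}\to\mathbb{R}$ be Lipschitz continuous $T$-periodic functions with $a_i(t)\le b_i(t)$ for all $t$. Set $$C(t)=\prod_{i=1}^n[a_i(t),b_i(t)]\subset\mathbb{R}^n.$$ Then every solution $x\colon[0,+\infty)\to\mathbb{R}^n$ of $$\dot x(t)\in-\mathcal{N}_{C(t)}(x(t))$$ with initial condition $x(0)\in C(0)$ is $T$-periodic in $[T,+\infty)$, i.e. $x(t+T)=x(t)$ for every $t\ge T$.
   Context: $\mathcal{N}_{C}(x)=\{v\in\mathbb{R}^n:\langle v,y-x\rangle\le 0\ \forall y\in C\}$ is the normal cone of convex analysis to a closed convex set $C$ at $x\in C$. A solution is a (locally) absolutely continuous function $x$ with $x(t)\in C(t)$ for every $t$, satisfying the inclusion for a.e. $t$. *)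

(* Defs.v *)
From mathcomp Require Import all_boot all_order all_algebra.
From mathcomp Require Import all_classical all_reals all_analysis.

Set Implicit Arguments.
Unset Strict Implicit.
Unset Printing Implicit Defensive.

Import Order.TTheory GRing.Theory Num.Theory.
Import numFieldNormedType.Exports.

Local Open Scope classical_set_scope.
Local Open Scope ring_scope.

Definition dotp (R : realType) (n : nat) (u v : 'rV[R]_n) : R :=
  \sum_(i < n) u 0 i * v 0 i.

(* Meant for [C] closed and convex and [x] in [C]. *)
Definition normal_cone (R : realType) (n : nat) (C : set 'rV[R]_n)
    (x : 'rV[R]_n) : set 'rV[R]_n :=
  [set v | forall y, C y -> dotp v (y - x) <= 0].

Definition box (R : realType) (n : nat) (a b : 'I_n -> R) : set 'rV[R]_n :=
  [set y | forall i, a i <= y 0 i <= b i].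

(* Epsilon-delta absolute continuity on [`[c, d]]; on ['rV[R]_n] the library
   norm is the sup norm, and equivalent norms give the same notion. *)
Definition abs_continuous (R : realType) (V : normedModType R) (c d : R)
    (f : R -> V) : Prop :=
  forall e : R, 0 < e -> exists2 delta : R, 0 < delta &
    forall (k : nat) (u v : 'I_k -> R),
      (forall j, [/\ c <= u j, u j < v j & v j <= d]) ->
      trivIset [set: 'I_k] (fun j => `]u j, v j[%classic) ->
      \sum_(j < k) (v j - u j) < delta ->
      \sum_(j < k) `|f (v j) - f (u j)| < e.

(* Solutions on [0, +oo[ of [x'(t) \in - N_{C(t)}(x(t))].  [x] is a total
   function, but its values at negative times are irrelevant: the two-sided
   derivative is only taken at [t > 0], and [t = 0] is negligible. *)
Definition sweeping_solution (R : realType) (n : nat)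
    (C : R -> set 'rV[R]_n) (x : R -> 'rV[R]_n) : Prop :=
  [/\ forall d : R, 0 < d -> abs_continuous 0 d x,
      forall t : R, 0 <= t -> C t (x t) &
      {ae lebesgue_measure, forall t : R, 0 < t ->
        derivable x t 1 /\
        [set - v | v in normal_cone (C t) (x t)] (derive1 x t)}].

(* Main.v *)
(** The coordinates of a solution decouple into scalar sweeping processes [f]
    with values in [[lo t, hi t]]. The inclusion gives [f' >= 0] a.e. where
    [f < hi] and [f' <= 0] a.e. where [lo < f]; by absolute continuity, [f] is
    nondecreasing on intervals where [f < hi] and nonincreasing on intervals
    where [lo < f]. Put [z t = f (t + T) - f t]. While [z > 0], periodicity of
    the constraint gives [f t < f (t + T) <= hi t] and
    [lo (t + T) <= f t < f (t + T)], so [f] does not decrease near [t] and does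
    not increase near [t + T]. So [z] cannot increase while positive, and
    [z <= 0] persists once it holds. If [z > 0] held on all of [[0, T]], then
    [f 0 <= f T] and [f (2 T) <= f T], contradicting [z T > 0]; so [z <= 0] on
    [[T, +oo[], and [z >= 0] follows by applying this to [- f]. *)

Require Import Defs.
From mathcomp Require Import all_boot all_order all_algebra.
From mathcomp Require Import all_classical all_reals all_analysis.
From mathcomp Require Import measurable_realfun ring lra.

Import Order.TTheory GRing.Theory Num.Theory.
Import numFieldNormedType.Exports.

Local Open Scope classical_set_scope.
Local Open Scope ring_scope.

(** * Monotonicity from the sign of the derivative almost everywhere *)

(* Cousin's lemma, phrased as induction along [[c, d]] by small steps that
   straddle a point [s]. *)
Lemma interval_chaining (R : realType) (c d : R) (P : R -> Prop) :
  c <= d -> P c ->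
  (forall s, c <= s <= d -> exists2 r : R, 0 < r &
     forall u v, c <= u -> u <= s -> s <= v -> v <= d ->
       s - u < r -> v - s < r -> P u -> P v) ->
  P d.
Proof.
move=> cd Pc step.
pose E := [set s | c <= s <= d /\ P s].
have Ec : E c by split=> //; rewrite lexx.
have ubE : has_ubound E by exists d => s [/andP[]].
have supE : has_sup E by split=> //; exists c.
have cs : c <= sup E by apply: ub_le_sup.
have sd : sup E <= d by apply: ge_sup; [exists c|move=> s [/andP[]]].
have [|r r0 stepr] := step (sup E); first by rewrite cs.
have [e [/andP[ce ed] Pe] ge] := sup_adherent r0 supE.
have es : e <= sup E by apply: ub_le_sup => //; split=> //; rewrite ce.
(* Either [d] is within reach of the supremum, or one step passes beyond it to [sup E + r / 2],
   which is absurd. *)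
have [dr|dr] := ltP (d - sup E) r.
  by apply: (stepr e) => //; lra.
have Em : E (sup E + r / 2).
  split; first by lra.
  by apply: (stepr e) => //; lra.
have := ub_le_sup ubE Em; lra.
Qed.

(** Difference quotients based at [t] exceed [- eps] near [t]; the estimates on the two sides of [t]
    add up. *)
Lemma derive_straddle (R : realType) (f : R -> R) (t eps : R) :
  0 < eps -> derivable f t 1 -> 0 <= derive1 f t ->
  exists2 r : R, 0 < r & forall u v, u <= t -> t <= v -> t - u < r ->
    v - t < r -> f u - f v <= eps * (v - u).
Proof.
move=> e0 df; rewrite derive1E => f'0.
have : \forall h \near (0 : R)^', - eps < h^-1 *: (f (h *: 1 + t) - f t).
  by apply: (cvgr_gt ('D_1 f t)) => //; lra.
rewrite near_withinE => /nbhs_ballP[r /= r0 fr].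
have q h : `|h| < r -> h != 0 -> - eps < h^-1 * (f (h + t) - f t).
  move=> hr h0; have := fr h; rewrite /ball /= sub0r normrN => /(_ hr h0).
  by rewrite /GRing.scale /= mulr1.
exists r => // u v ut tv ur vr.
have A : f t - f v <= eps * (v - t).
  have [->|vt] := eqVneq v t; first by lra.
  have p : 0 < v - t by rewrite subr_gt0 lt_neqAle eq_sym vt.
  have := q (v - t); rewrite subrK gtr0_norm // => /(_ vr (lt0r_neq0 p)).
  by rewrite ltr_pdivlMl //; lra.
have B : f u - f t <= eps * (t - u).
  have [->|vt] := eqVneq u t; first by lra.
  have p : u - t < 0 by rewrite subr_lt0 lt_neqAle vt.
  have := q (u - t); rewrite subrK ltr0_norm // opprB => /(_ ur (ltr0_neq0 p)).
  by rewrite ltr_ndivlMl //; lra.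
lra.
Qed.

Lemma sum_length_le (R : realType) (k : nat) (u v : nat -> R) (U : set R) :
  open U ->
  (forall j, (j < k)%N -> u j < v j /\ `]u j, v j[%classic `<=` U) ->
  trivIset `I_k (fun j => `]u j, v j[%classic) ->
  ((\sum_(j < k) (v j - u j))%:E <= lebesgue_measure U)%E.
Proof.
move=> oU uvU tI.
have -> : (\sum_(j < k) (v j - u j))%:E =
    lebesgue_measure (\bigcup_(j in `I_k) `]u j, v j[%classic).
  rewrite -sumEFin measure_fin_bigcup //.
  rewrite -(fsbig_ord _ _ (fun j => lebesgue_measure `]u j, v j[%classic)).
  apply: eq_bigr => j _.
  by rewrite lebesgue_measure_itv /= lte_fin (uvU j _).1.
apply: le_measure; rewrite ?inE.
- by apply: bigcup_measurable => j _; exact: measurable_itv.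
- exact: open_measurable.
- by move=> z [j jk]; exact: (uvU j jk).2.
Qed.

(* Small steps across a point where [f' >= 0] lose at most [e] times their
   length; steps across exceptional points stay in an open set [U] of small
   measure, on which absolute continuity bounds the total variation. *)
Lemma ac_nondecreasing (R : realType) (c d : R) (f : R -> R) :
  c <= d -> abs_continuous c d f ->
  {ae lebesgue_measure, forall t : R, c < t < d ->
    derivable f t 1 /\ 0 <= derive1 f t} ->
  f c <= f d.
Proof.
move=> cd acf aef.
(* The endpoints join the exceptional null set, since the chaining visits all of [[c, d]] and the
   hypothesis covers only its interior. *)
have [A [mA A0 subA]] : lebesgue_measure.-negligible
    (~` [set t | c < t < d -> derivable f t 1 /\ 0 <= derive1 f t] `|`
       ([set c] `|` [set d])).
  apply: negligibleU => //; apply: negligibleU; apply/negligibleP => //;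
    exact: lebesgue_measure_set1.
have good t : c <= t <= d -> ~ A t -> derivable f t 1 /\ 0 <= derive1 f t.
  move=> /andP[ct td] nA.
  have nN := contra_not (@subA t) nA.
  have [tc|tc] := eqVneq t c; first by case: nN; right; left.
  have [td'|td'] := eqVneq t d; first by case: nN; right; right.
  have P : c < t < d by rewrite !lt_neqAle eq_sym tc ct td' td.
  by apply: contrapT => h; apply: nN; left => /(_ P).
suff main (e : R) : 0 < e -> f c - f d <= e * (d - c) + e.
  rewrite leNgt; apply/negP => fdc.
  have D : 0 < d - c + 1 by lra.
  (* With this [e] the bound [e * (d - c) + e] is half of [f c - f d]. *)
  have e0 : 0 < (f c - f d) / (2 * (d - c + 1)) by rewrite divr_gt0; lra.
  have := main _ e0; set e := _ / _.
  have : e * (d - c + 1) = (f c - f d) / 2 by rewrite /e; field; lra.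
  lra.
move=> e0; have [delta delta0 acfe] := acf e e0.
have [|U [oU AU UA]] := @lebesgue_regularity_outer R A delta mA _ delta0.
  by rewrite [ltLHS]A0.
have Udelta : (lebesgue_measure U < delta%:E)%E.
  rewrite -(setDKU AU) (le_lt_trans (measureU2 _ _ mA)) //;
    rewrite ?[X in (_ + X)%E]A0 ?adde0 //.
  by apply: measurableD => //; exact: open_measurable.
(* The intervals record the steps made so far across exceptional points; listing them from left to
   right makes them disjoint. *)
pose P t := exists k (u v : nat -> R), [/\
  forall j, (j < k)%N ->
    [/\ c <= u j, u j < v j, v j <= t & `]u j, v j[%classic `<=` U],
  forall i j, (i < j)%N -> (j < k)%N -> v i <= u j &
  f c - f t <= e * (t - c) + \sum_(j < k) `|f (v j) - f (u j)|].
have [k [u [v [uv ord le]]]] : P d.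
  apply: (interval_chaining _ c) => //.
    by exists 0%N, (fun=> 0), (fun=> 0); split=> //; rewrite big_ord0; lra.
  move=> s csd; have [As|nAs] := pselect (A s); last first.
    have [ds d0] := good s csd nAs.
    have [r r0 fr] := derive_straddle _ _ _ _ e0 ds d0; exists r => //.
    move=> p q cp ps sq qd pr qr [k [u [v [uv ord le]]]].
    exists k, u, v; split=> //.
      by move=> j /uv[? ? ? ?]; split=> //; lra.
    have := fr p q ps sq pr qr; lra.
  have /nbhs_ballP[r /= r0 rU] : nbhs s U.
    by apply: open_nbhs_nbhs; split=> //; exact: AU.
  exists r => // p q cp ps sq qd pr qr [k [u [v [uv ord le]]]].
  (* A step of length zero is not recorded, as [u j < v j] is strict. *)
  have [->|pq] := eqVneq q p; first by exists k, u, v.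
  have {}pq : p < q by rewrite lt_neqAle eq_sym pq; lra.
  exists k.+1, (fun j => if j == k then p else u j),
    (fun j => if j == k then q else v j); split.
  - move=> j jk; case: eqVneq => [_|jk'].
      split=> // z /=; rewrite in_itv /= => /andP[pz zq].
      by apply: rU; rewrite /ball /= ltr_distlC; lra.
    by have /uv[? ? ? ?] : (j < k)%N; [rewrite ltn_neqAle jk'|split=> //; lra].
  - move=> i j ij jk; have ik : (i < k)%N by exact: leq_trans ij jk.
    rewrite (ltn_eqF ik); case: eqVneq => [_|jk'].
      by have [] := uv i ik; lra.
    by apply: ord => //; rewrite ltn_neqAle jk'.
  - rewrite big_ord_recr /= eqxx.
    rewrite (eq_bigr (fun j : 'I_k => `|f (v j) - f (u j)|)); last first.
      by move=> j _; rewrite ltn_eqF.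
    have := ler_norm (- (f q - f p)); rewrite normrN.
    suff : e * (p - c) <= e * (q - c) by lra.
    by rewrite ler_pM2l //; lra.
have tI : trivIset `I_k (fun j => `]u j, v j[%classic).
  move=> i j /= ik jk [z [/=]].
  rewrite !in_itv /= => /andP[uiz zvi] /andP[ujz zvj].
  have [ij|ji|//] := ltngtP i j.
    by have := ord i j ij jk; rewrite leNgt (lt_trans ujz zvi).
  by have := ord j i ji ik; rewrite leNgt (lt_trans uiz zvj).
apply: (le_trans le); rewrite lerD2l; apply/ltW.
apply: (acfe k (u \o val) (v \o val)) => /=.
- by move=> j; have [] := uv j (ltn_ord j).
- by move=> i j _ _ /(tI i j (ltn_ord i) (ltn_ord j)) /val_inj.
- rewrite -lte_fin (le_lt_trans _ Udelta) //; apply: sum_length_le => //.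
  by move=> j /uv[].
Qed.

(** * Scalar sweeping processes *)

(** The last condition says that [- f'] lies in the normal cone to the interval [[lo t, hi t]] at
    [f t]. *)
Definition scalar_sweeping {R : realType} (lo hi f : R -> R) : Prop :=
  [/\ forall d : R, 0 < d -> abs_continuous 0 d f,
      forall t : R, 0 <= t -> lo t <= f t <= hi t &
      {ae lebesgue_measure, forall t : R, 0 < t ->
        derivable f t 1 /\
        forall w, lo t <= w <= hi t -> 0 <= derive1 f t * (w - f t)}].

Lemma scalar_sweepingN (R : realType) (lo hi f : R -> R) :
  scalar_sweeping lo hi f -> scalar_sweeping (- hi) (- lo) (- f).
Proof.
move=> [acf bf aef]; split.
- move=> d d0 e e0; have [r r0 acr] := acf d d0 e e0; exists r => //.
  move=> k u v uv tI uvr; rewrite (le_lt_trans _ (acr k u v uv tI uvr)) //.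
  by apply: ler_sum => j _; rewrite /= -opprD normrN.
- by move=> t /bf; rewrite !fctE !lerN2 andbC.
- have aeF := ae_filter_ringOfSetsType (@lebesgue_measure R).
  apply: filterS aef => t ft /ft[df wf]; split; first exact: derivableN.
  move=> w; rewrite !fctE /= => wlh; rewrite derive1E deriveN // -derive1E.
  have /wf : lo t <= - w <= hi t by rewrite lerNr lerNl andbC.
  by rewrite mulNr -mulrN opprD opprK.
Qed.

Lemma scalar_sweeping_le (R : realType) (lo hi f : R -> R) (c d : R) :
  scalar_sweeping lo hi f -> 0 <= c -> c <= d ->
  (forall t, c < t < d -> f t < hi t) -> f c <= f d.
Proof.
move=> [acf bf aef] c0 cd fhi.
have [->//|cd'] := eqVneq c d.
have d0 : 0 < d by rewrite (le_lt_trans c0) // lt_neqAle cd'.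
apply: ac_nondecreasing => //.
  move=> e e0; have [r r0 acr] := acf d d0 e e0; exists r => // k u v uv.
  by apply: acr => j; have [cu ? ?] := uv j; rewrite (le_trans c0).
have aeF := ae_filter_ringOfSetsType (@lebesgue_measure R).
apply: filterS aef => t ft ctd.
have t0 : 0 < t by lra.
have [df wf] := ft t0; split=> //.
have hi_f : 0 < hi t - f t by rewrite subr_gt0 fhi.
have /andP[lof fhi'] := bf t (ltW t0).
(* Testing the normal cone with [w = hi t] fixes the sign of the derivative. *)
by have := wf (hi t); rewrite pmulr_lge0 // lexx (le_trans lof fhi'); apply.
Qed.

Lemma scalar_sweeping_ge (R : realType) (lo hi f : R -> R) (c d : R) :
  scalar_sweeping lo hi f -> 0 <= c -> c <= d ->
  (forall t, c < t < d -> lo t < f t) -> f d <= f c.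
Proof.
move=> /scalar_sweepingN sf c0 cd lof; rewrite -lerN2.
apply: (scalar_sweeping_le _ _ _ _ _ _ sf) => // t /lof.
by rewrite !fctE ltrN2.
Qed.

(** This is absolute continuity for a family of one interval. *)
Lemma scalar_sweeping_uniform_continuous (R : realType) (lo hi f : R -> R)
    (d e : R) :
  scalar_sweeping lo hi f -> 0 < e ->
  exists2 r, 0 < r & forall u v, 0 <= u -> u < v -> v <= d -> v - u < r ->
    `|f v - f u| < e.
Proof.
move=> [acf _ _] e0; have [d0|d0] := leP d 0.
  by exists 1 => // u v; lra.
have [r r0 acr] := acf d d0 e e0; exists r => // u v u0 uv vd vur.
have := acr 1%N (fun=> u) (fun=> v); rewrite !big_ord1; apply=> //.
by move=> i j _ _ _; rewrite (ord1 i) (ord1 j).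
Qed.

(** * Comparison with the shift by one period *)

Lemma scalar_sweeping_shift_le (R : realType) (T : R) (lo hi f : R -> R)
    (c d : R) :
  0 < T -> periodic lo T -> scalar_sweeping lo hi f ->
  0 <= c -> c <= d -> (forall t, c < t < d -> f t < f (t + T)) ->
  f (d + T) <= f (c + T).
Proof.
move=> T0 perlo sf c0 cd flt.
apply: (scalar_sweeping_ge _ _ _ _ _ _ sf) => [||t ctd]; [lra|lra|].
have := flt (t - T); rewrite subrK -[in lo t](subrK T t) perlo.
move=> /(_ ltac:(lra)).
by case: sf => _ /(_ (t - T) ltac:(lra)) /andP[+ _] _; apply: le_lt_trans.
Qed.

Lemma scalar_sweeping_le_shift (R : realType) (T : R) (lo hi f : R -> R)
    (c d : R) :
  0 < T -> periodic hi T -> scalar_sweeping lo hi f ->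
  0 <= c -> c <= d -> (forall t, c < t < d -> f t < f (t + T)) ->
  f c <= f d.
Proof.
move=> T0 perhi sf c0 cd flt.
apply: (scalar_sweeping_le _ _ _ _ _ _ sf) => // t ctd.
apply: (lt_le_trans (flt t ctd)); rewrite -perhi.
by case: sf => _ /(_ (t + T) ltac:(lra)) /andP[].
Qed.

Lemma scalar_sweeping_shift_absorb (R : realType) (T : R) (lo hi f : R -> R)
    (c d : R) :
  0 < T -> periodic lo T -> periodic hi T -> scalar_sweeping lo hi f ->
  0 <= c -> c <= d -> f (c + T) <= f c -> f (d + T) <= f d.
Proof.
move=> T0 perlo perhi sf c0 cd fc.
pose E := [set t | c <= t <= d /\ f (t + T) <= f t].
have Ec : E c by split=> //; rewrite lexx.
have ubE : has_ubound E by exists d => t [/andP[]].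
have supE : has_sup E by split=> //; exists c.
(* [s] turns out to be the last time in [[c, d]] at which [f (t + T) <= f t]. *)
set s := sup E.
have cs : c <= s by apply: ub_le_sup.
have sd : s <= d by apply: ge_sup; [exists c|move=> t [/andP[]]].
have fs : f (s + T) <= f s.
  rewrite leNgt; apply/negP => fsT.
  (* Half the gap suffices: from a nearby [t] in [E], [f] changes by less than this both up to [s]
     and from [t + T] to [s + T], so the gap cannot open. *)
  have e0 : 0 < (f (s + T) - f s) / 2 by lra.
  have [r r0 fr] :=
    scalar_sweeping_uniform_continuous _ _ _ _ (d + T) _ sf e0.
  have [t [/andP[ct td] ft] str] := sup_adherent r0 supE.
  have ts : t <= s by apply: ub_le_sup => //; split=> //; rewrite ct.
  have [tsE|ts'] := eqVneq t s; first by rewrite tsE in ft; lra.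
  have lts : t < s by rewrite lt_neqAle ts'.
  have := fr t s; have := fr (t + T) (s + T).
  rewrite !ltr_norml -/s in str *.
  move=> /(_ ltac:(lra) ltac:(lra) ltac:(lra) ltac:(lra)) /andP[? ?].
  move=> /(_ ltac:(lra) ltac:(lra) ltac:(lra) ltac:(lra)) /andP[? ?]; lra.
have flt t : s < t < d -> f t < f (t + T).
  move=> std; rewrite ltNge; apply/negP => ft.
  by have : t <= s; [apply: ub_le_sup => //; split=> //|]; lra.
have s0 : 0 <= s by lra.
(* The chain is [f (d + T) <= f (s + T) <= f s <= f d]. *)
have := scalar_sweeping_shift_le _ _ _ _ _ _ _ T0 perlo sf s0 sd flt.
have := scalar_sweeping_le_shift _ _ _ _ _ _ _ T0 perhi sf s0 sd flt.
lra.
Qed.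

Lemma scalar_sweeping_shift_after_period_le (R : realType) (T : R)
    (lo hi f : R -> R) (t : R) :
  0 < T -> periodic lo T -> periodic hi T -> scalar_sweeping lo hi f ->
  T <= t -> f (t + T) <= f t.
Proof.
move=> T0 perlo perhi sf Tt.
suff [c [c0 cT fc]] : exists c, [/\ 0 <= c, c <= T & f (c + T) <= f c].
  apply: (scalar_sweeping_shift_absorb _ _ _ _ _ c _ T0 perlo perhi sf) => //.
  lra.
apply: contrapT => noc.
have flt u : 0 <= u -> u <= T -> f u < f (u + T).
  by move=> u0 uT; rewrite ltNge; apply/negP => fu; apply: noc; exists u.
have flt' u : 0 < u < T -> f u < f (u + T) by move=> ?; apply: flt; lra.
have := scalar_sweeping_shift_le _ _ _ _ _ _ _ T0 perlo sf
  (lexx 0) (ltW T0) flt'.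
have := scalar_sweeping_le_shift _ _ _ _ _ _ _ T0 perhi sf
  (lexx 0) (ltW T0) flt'.
have := flt T (ltW T0) (lexx T).
rewrite add0r; lra.
Qed.

Lemma scalar_sweeping_periodic (R : realType) (T : R) (lo hi f : R -> R)
    (t : R) :
  0 < T -> periodic lo T -> periodic hi T -> scalar_sweeping lo hi f ->
  T <= t -> f (t + T) = f t.
Proof.
move=> T0 perlo perhi sf Tt; apply/eqP; rewrite eq_le.
rewrite (scalar_sweeping_shift_after_period_le _ _ _ _ _ _ T0 perlo perhi) //=.
rewrite -lerN2.
apply: (scalar_sweeping_shift_after_period_le _ _ (- hi) (- lo) (- f)) => //.
- by move=> u; rewrite !fctE perhi.
- by move=> u; rewrite !fctE perlo.
- exact: scalar_sweepingN.
Qed.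

(** * Reduction to coordinates *)

Lemma sweeping_solution_coord (R : realType) (n : nat) (a b : 'I_n -> R -> R)
    (x : R -> 'rV[R]_n) (i : 'I_n) :
  sweeping_solution (fun t => box (fun i => a i t) (fun i => b i t)) x ->
  scalar_sweeping (a i) (b i) (fun t => x t 0 i).
Proof.
move=> [acx Cx aex]; split.
- move=> d d0 e e0; have [r r0 acr] := acx d d0 e e0; exists r => //.
  move=> k u v uv tI uvr; rewrite (le_lt_trans _ (acr k u v uv tI uvr)) //.
  apply: ler_sum => j _.
  have -> : x (v j) 0 i - x (u j) 0 i = (x (v j) - x (u j)) 0 i by rewrite !mxE.
  rewrite [leRHS]mx_normrE.
  exact: (le_bigmax _ (fun p => `|(x (v j) - x (u j)) p.1 p.2|) (0, i)).
- by move=> t /Cx.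
- have aeF := ae_filter_ringOfSetsType (@lebesgue_measure R).
  apply: filterS aex => t xt t0; have [dx [v Nv dxv]] := xt t0.
  have Cxt := Cx t (ltW t0).
  have /derivable_mxP dxi := dx; split; first exact: dxi.
  move=> w wab.
  have -> : derive1 (fun t => x t 0 i) t = - v 0 i.
    by move: dxv; rewrite !derive1E derive_mx // => /rowP/(_ i); rewrite !mxE.
  (* Changing only coordinate [i] of [x t] stays in the box and leaves a single term of the inner
     product. *)
  have := Nv (\row_j (if j == i then w else x t 0 j)).
  rewrite mulNr oppr_ge0 /dotp (bigD1 i) //= !mxE eqxx big1 ?addr0.
    apply=> j; rewrite mxE; case: eqVneq => [->//|_]; exact: Cxt.
  by move=> j ji; rewrite !mxE (negbTE ji) subrr mulr0.
Qed.

Theorem corollary14 (R : realType) (n : nat) (T : R) (a b : 'I_n -> R -> R)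
  (T_gt0 : 0 < T)
  (a_lip : forall i, lipschitz (a i))
  (b_lip : forall i, lipschitz (b i))
  (a_per : forall i, periodic (a i) T)
  (b_per : forall i, periodic (b i) T)
  (le_ab : forall i t, a i t <= b i t) :
  let C : R -> set 'rV[R]_n :=
    fun t => box (fun i => a i t) (fun i => b i t) in
  forall x : R -> 'rV[R]_n,
    sweeping_solution C x -> C 0 (x 0) ->
    forall t : R, T <= t -> x (t + T) = x t.
Proof.
move=> C x Cx _ t Tt; apply/rowP => i.
have sxi := sweeping_solution_coord _ _ _ _ _ i Cx.
exact: (scalar_sweeping_periodic _ _ _ _ _ _ T_gt0 (a_per i) (b_per i) sxi Tt).
Qed.
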